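(* For any one-cusped hyperbolic orbifold $M_{(p,q)}$ obtained by $(p,q)$-Dehn filling on a cusp of the Berge manifold $M$, the trace field, the invariant trace field and the cusp field of $M_{(p,q)}$ coincide.
   Context: The Berge manifold $M$ is the two-cusped orientable hyperbolic 3-manifold that SnapPy identifies as \texttt{m202}; it is made of four regular ideal tetrahedra, is the complement in $S^3$ of a two-component link with one unknotted and one knotted component, and has a triangulation with isomorphism signature \texttt{eLMkbbdddemdxi\_baBddIaBBrt}. Dehn filling: Let $c$ be a torus cusp with cusp cross-section $\mathbb{T}$ and let $(\mathbf{m},\mathbf{l})$ be an oriented generating pair of $H_1(\mathbb{T};\mathbb{Z})$. For integers $(p,q)\neq(0,0)$ with $d=\gcd(p,q)$, the $(p,q)$-Dehn filling of $c$ removes an open neighborhood of $c$ and, if $d=1$, glues in a solid torus whose meridian is attached to $p\mathbf{m}+q\mathbf{l}$. If $d>1$, it glues in a solid orbi-torus of order $d$ (the quotient of a solid torus by an order-$d$ rotation about its core) correspondingly, giving an orbifold whose singular locus is the core curve, of order $d$. The other cusp is left unfilled and is a torus cusp of $M_{(p,q)}$. Fields: write the hyperbolic orbifold as $\mathbb{H}^3/\Gamma$ with $\Gamma<\mathrm{PSL}_2(\mathbb{C})$ discrete of finite covolume. The trace field is $\mathbb{Q}(\{\operatorname{tr}\gamma:\gamma\in\Gamma\})$ (traces up to sign), and the invariant trace field is the trace field of the subgroup $\Gamma^{(2)}=\langle\gamma^2:\gamma\in\Gamma\rangle$. For a torus cusp, the stabilizer in $\Gamma$ of a corresponding parabolic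 fixed point is a lattice of translations; for an oriented generating pair $(\mathbf{m},\mathbf{l})$ of it, viewed as complex numbers, the cusp modulus is $\mathbf{l}/\mathbf{m}$ (in the upper half-plane) and the cusp field is $\mathbb{Q}(\mathbf{l}/\mathbf{m})$, which does not depend on the pair. *)

(* Defs.v *)
From HB Require Import structures.
From mathcomp Require Import all_boot all_order all_algebra.
From mathcomp Require Import all_classical all_reals all_analysis.
From mathcomp Require Import complex.

Set Implicit Arguments.
Unset Strict Implicit.
Unset Printing Implicit Defensive.

Import Order.TTheory GRing.Theory Num.Theory.

Local Open Scope classical_set_scope.
Local Open Scope ring_scope.

(** * The Berge manifold as an ideal triangulation *)

Inductive idx := i0 | i1 | i2 | i3.

(* (t, f) is the face opposite to vertex f of tetrahedron t, seen from t; as a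
   letter it stands for crossing that face, out of t. *)
Definition face := (idx * idx)%type.

Definition word := seq face.

Definition vperm (a b c d : idx) (x : idx) : idx :=
  match x with i0 => a | i1 => b | i2 => c | i3 => d end.

(* The triangulation with isomorphism signature eLMkbbdddemdxi: face (t, f) is
   glued to tetrahedron (glue (t, f)).1 so that vertex x of t goes to vertex
   (glue (t, f)).2 x; in particular f goes to the vertex opposite to the face
   through which one enters. *)
Definition glue (a : face) : idx * (idx -> idx) :=
  match a with
  | (i0, i0) => (i1, vperm i0 i1 i2 i3)
  | (i0, i1) => (i2, vperm i0 i1 i2 i3)
  | (i0, i2) => (i1, vperm i0 i3 i1 i2)
  | (i0, i3) => (i1, vperm i2 i0 i1 i3)
  | (i1, i0) => (i0, vperm i0 i1 i2 i3)
  | (i1, i1) => (i0, vperm i0 i2 i3 i1)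
  | (i1, i2) => (i3, vperm i0 i1 i2 i3)
  | (i1, i3) => (i0, vperm i1 i2 i0 i3)
  | (i2, i0) => (i3, vperm i0 i2 i3 i1)
  | (i2, i1) => (i0, vperm i0 i1 i2 i3)
  | (i2, i2) => (i3, vperm i3 i2 i1 i0)
  | (i2, i3) => (i3, vperm i1 i2 i0 i3)
  | (i3, i0) => (i2, vperm i0 i3 i1 i2)
  | (i3, i1) => (i2, vperm i3 i2 i1 i0)
  | (i3, i2) => (i1, vperm i0 i1 i2 i3)
  | (i3, i3) => (i2, vperm i2 i0 i1 i3)
  end.

Definition opp_face (a : face) : face := ((glue a).1, (glue a).2 a.2).

Lemma opp_faceK (a : face) : opp_face (opp_face a) = a.
Proof. by case: a => -[] []. Qed.

Lemma glueK (a : face) (x : idx) : (glue (opp_face a)).2 ((glue a).2 x) = x.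
Proof. by case: a => -[] []; case: x. Qed.

(* The state (t, f, g) describes the edge of t shared by its faces f and g; one
   step crosses f and stays around the same edge. *)
Definition edge_step (s : idx * idx * idx) : idx * idx * idx :=
  let: (t, f, g) := s in
  ((glue (t, f)).1, (glue (t, f)).2 g, (glue (t, f)).2 f).

Definition edge_word (s : idx * idx * idx) : word :=
  [seq x.1 | x <- traject edge_step s 6].

(* Every edge has degree exactly 6. *)
Lemma edge_step6 (s : idx * idx * idx) : s.1.2 <> s.2 ->
  iter 6 edge_step s = s /\ (forall k, (0 < k < 6)%N -> iter k edge_step s <> s).
Proof.
destruct s as [[t f] g]; intro fg; split.
  destruct t, f, g; vm_compute; reflexivity.
intros k hk; destruct k as [|[|[|[|[|[|k]]]]]]; try discriminate hk; clear hk;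
  destruct t, f, g;
  first [exfalso; apply fg; reflexivity | vm_compute; discriminate].
Qed.

(** * Fundamental groups *)

(* Faces of the dual 1-skeleton forming the maximal tree 2 - 0 - 1 - 3. *)
Definition in_tree (a : face) : bool :=
  match a with (i0, i0) | (i0, i1) | (i1, i2) => true | _ => false end.

(* Presentation of pi_1(M) from the 2-complex dual to the triangulation. *)
Inductive berge_rel : word -> Prop :=
| rel_tree a : in_tree a -> berge_rel [:: a]
| rel_face a : berge_rel [:: a; opp_face a]
| rel_edge t f g : f <> g -> berge_rel (edge_word (t, f, g)).

Section Presentation.
Variable rel : word -> Prop.

(* Equality in the monoid <face | rel>; it is a group as soon as rel contains
   the words [:: a; opp_face a]. *)
Inductive eqw : word -> word -> Prop :=
| eqw_refl w : eqw w w
| eqw_sym w1 w2 : eqw w1 w2 -> eqw w2 w1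
| eqw_trans w1 w2 w3 : eqw w1 w2 -> eqw w2 w3 -> eqw w1 w3
| eqw_rel u r v : rel r -> eqw (u ++ r ++ v) (u ++ v).

End Presentation.

Definition winv (w : word) : word := rev (map opp_face w).

Definition wpow (w : word) (k : int) : word :=
  match k with
  | Posz n => flatten (nseq n w)
  | Negz n => flatten (nseq n.+1 (winv w))
  end.

(** * Cusps *)

(* An ideal vertex (t, v) is a triangle of the cusp cross-sections. A path in
   the cross-section crosses the sides (t, f) of this triangle, f <> v. *)
Inductive link_path : idx * idx -> word -> idx * idx -> Prop :=
| link_nil x : link_path x [::] x
| link_cons t v f w y : f <> v ->
    link_path ((glue (t, f)).1, (glue (t, f)).2 v) w y ->
    link_path (t, v) ((t, f) :: w) y.

(* The ideal vertices (2, 1) and (3, 2) form one cusp, the fourteen other ones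
   form the other cusp. *)
Definition cusp_base (c : bool) : idx * idx :=
  if c then (i2, i1) else (i0, i0).

(* Closed paths in the cross-section of cusp c, as elements of pi_1(M). They
   are moved to the base point of M along the maximal tree, whose letters are
   trivial. *)
Definition peripheral (c : bool) (w : word) : Prop :=
  link_path (cusp_base c) w (cusp_base c).

(* (m, l) generates H_1(T; Z) = pi_1(T), T being the cross-section of c. As T is
   incompressible, this can be tested in pi_1(M). The orientation of the pair is
   irrelevant, since (m, l^-1) has the same fillings as (m, l). *)
Definition generating_pair (c : bool) (m l : word) : Prop :=
  [/\ peripheral c m, peripheral c l &
      forall w, peripheral c w ->
        exists a b : int, eqw berge_rel w (wpow m a ++ wpow l b)].

(* Presentation of the orbifold fundamental group of the (p, q)-filling: a
   meridian of a solid orbi-torus of order d = gcd(p, q) has order d, so that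
   the element to kill is (m^(p/d) l^(q/d))^d = m^p l^q for all d >= 1. *)
Definition filling_rel (m l : word) (p q : int) (r : word) : Prop :=
  berge_rel r \/ r = wpow m p ++ wpow l q.

Section Hyperbolic.
Variable R : realType.
Local Notation C := R[i].
Local Notation M2 := 'M[R[i]]_2.

(** * Subgroups of PSL_2(C), given by their preimages in SL_2(C) *)

Definition discrete (G : set M2) : Prop :=
  forall g, G g -> exists2 e : R, 0 < e &
    forall h, G h -> (forall i j, `|h i j - g i j| < e%:C%C) -> h = g.

Definition sqnorm (z : C) : R := complex.Re z ^+ 2 + complex.Im z ^+ 2.

(* A point ((x, y), t) with t > 0 is the point (x + i y, t) of the upper
   half-space model of H^3. *)
Definition H3 : set (R * R * R) := [set P | 0 < P.2].

(* Poincare extension of z |-> (a z + b) / (c z + d). *)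
Definition act (g : M2) (P : R * R * R) : R * R * R :=
  let z : C := (P.1.1 +i* P.1.2)%C in
  let t := P.2 in
  let a := g 0 0 in let b := g 0 1 in let c := g 1 0 in let d := g 1 1 in
  let den := sqnorm (c * z + d) + sqnorm c * t ^+ 2 in
  let num := (a * z + b) * (c * z + d)^*%C + a * c^*%C * (t ^+ 2)%:C%C in
  (complex.Re num / den, complex.Im num / den, t / den).

Definition hyp_volume (D : set (R * R * R)) : \bar R :=
  (\int[(lebesgue_measure \x lebesgue_measure) \x lebesgue_measure]_(P in D)
     ((P.2 ^+ 3)^-1)%:E)%E.

(* For a discrete G, the volume of H^3 / G is the least volume of a measurable
   set whose translates cover H^3. *)
Definition finite_covolume (G : set M2) : Prop :=
  exists D : set (R * R * R),
    [/\ measurable D, D `<=` H3,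
        forall P, H3 P -> exists2 g, G g & D (act g P) &
        (hyp_volume D < +oo)%E].

(** * Fields *)

Definition gen_field (S : set C) : set C :=
  smallest (fun K : set C => divring_closed [in K]) S.

Definition gen_group (S : set M2) : set M2 :=
  smallest (fun H : set M2 => divr_closed [in H]) S.

Definition trace_field (G : set M2) : set C := gen_field [set \tr g | g in G].

Definition invariant_trace_field (G : set M2) : set C :=
  trace_field (gen_group [set g ^+ 2 | g in G]).

Definition transl (z : C) : M2 :=
  \matrix_(i, j) (if i == j then 1 else if i == 0 then z else 0).

(* Elements of G that fix the point g(oo) of the sphere at infinity. *)
Definition stabilizer (G : set M2) (g : M2) : set M2 :=
  [set h | G h /\ (g^-1 * h * g) 1 0 = 0].

(* After moving g(oo) to oo, the stabilizer of g(oo) is the lattice of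
   translations Z m + Z l, with cusp modulus l / m in the upper half-plane. *)
Definition cusp_lattice (G : set M2) (g : M2) (m l : C) : Prop :=
  0 < complex.Im (l / m) /\
  forall h, stabilizer G g h <->
    exists a b : int, let h' := g * transl (m *~ a + l *~ b) * g^-1 in
      h = h' \/ h = - h'.

Definition cusp_field (m l : C) : set C := gen_field [set l / m].

(** * Hyperbolic Dehn fillings *)

Definition wordval (rho : face -> M2) (w : word) : M2 := \prod_(a <- w) rho a.

Definition holonomy_group (rho : face -> M2) : set M2 :=
  [set g | exists w, g = wordval rho w \/ g = - wordval rho w].

(* rho induces an isomorphism from the orbifold fundamental group of the
   (p, q)-filling of cusp c, with respect to (m, l), onto a discrete group G of
   finite covolume; the peripheral subgroup of the unfilled cusp is mapped onto
   the stabilizer of g(oo). *)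
Record hyperbolic_filling (c : bool) (m l : word) (p q : int)
    (rho : face -> M2) (g : M2) : Prop := HyperbolicFilling {
  hf_det : forall a, \det (rho a) = 1;
  hf_faithful : forall w,
    (wordval rho w = 1 \/ wordval rho w = -1) <->
    eqw (filling_rel m l p q) w [::];
  hf_discrete : discrete (holonomy_group rho);
  hf_covolume : finite_covolume (holonomy_group rho);
  hf_base : \det g = 1;
  hf_cusp : forall h, stabilizer (holonomy_group rho) g h <->
    exists2 w, peripheral (~~ c) w & h = wordval rho w \/ h = - wordval rho w
}.

End Hyperbolic.

(* Main.v *)
Require Import Defs.
From HB Require Import structures.
From mathcomp Require Import all_boot all_order all_algebra.
From mathcomp Require Import all_classical all_reals all_analysis.
From mathcomp Require Import complex ring zify.

Set Implicit Arguments.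
Unset Strict Implicit.
Unset Printing Implicit Defensive.

Import Order.TTheory GRing.Theory Num.Theory.

Local Open Scope classical_set_scope.
Local Open Scope ring_scope.

(** Why the three fields agree.

    Up to sign, the holonomy group G is generated by two matrices A, X, where X
    and a third element Y generate the peripheral group of the unfilled cusp,
    and the triangulation gives, up to sign, the relation
      [Y = A^2 X^-1 A^3 X^-1 A^2].
    The same relation holds whichever of the two cusps is left unfilled: the
    fundamental group has the presentation
      [<a, b | a b^-1 a^2 b^2 = b^2 a^2 b^-1 a>],
    which is symmetric in a and b, and one takes A = a for one cusp and A = b for
    the other ([loop_y_relator]).

    Move the parabolic fixed point to infinity, so that X and Y become the
    translations by x and y and A becomes a matrix of trace s with lower left
    entry c. The number c is nonzero: otherwise A would itself be a peripheral
    translation by some z = i x + j y, the relation would read 7 z = 2 x + y, and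
    this is impossible for integers i, j because x, y span a lattice of rank two
    ([conj_ll]). The matrix relation then implies
      [s (y - x) = x] and [s (s + 1) c x = s^3 + s^2 - 2 s - 1]
    ([relation_trace]). Hence s and c x are rational functions of y / x, a
    number of the cusp field. A conjugation turns X into the translation by 1 and
    A into a matrix with entries in Q(s, c x), so that all traces lie in the
    cusp field ([trace_over]).

    Conversely, for h = A^2, whose lower left entry c s is nonzero, and for a
    peripheral translation t by z, the elements h and t^2 h lie in the subgroup
    generated by squares, and tr(t^2 h) - tr(h) = 2 z c s. Taking the quotient
    for the two generators z = l, m of the cusp lattice puts l / m in the
    invariant trace field ([cusp_field_sub_invariant]). The invariant trace
    field is trivially contained in the trace field, which closes the circle. *)

(** * Matrices of size two *)

Section TwoByTwo.
Variable F : fieldType.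
Implicit Types (a b c d x y z : F) (M N : 'M[F]_2).

Definition mx2 a b c d : 'M[F]_2 :=
  \matrix_(i, j) if i == 0 then if j == 0 then a else b
                 else if j == 0 then c else d.

Lemma ord2E (i : 'I_2) : (i == 0) || (i == 1).
Proof. by case: i => [[|[|]]]. Qed.

Lemma mx2E M : M = mx2 (M 0 0) (M 0 1) (M 1 0) (M 1 1).
Proof.
apply/matrixP => i j; rewrite mxE.
by case/orP: (ord2E i) => /eqP ->; case/orP: (ord2E j) => /eqP ->.
Qed.

Lemma mx2_inj a b c d a' b' c' d' :
  mx2 a b c d = mx2 a' b' c' d' -> [/\ a = a', b = b', c = c' & d = d'].
Proof.
move/matrixP => E.
by split; [have := E 0 0|have := E 0 1|have := E 1 0|have := E 1 1]; rewrite !mxE.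
Qed.

Lemma mx2M a b c d a' b' c' d' :
  mx2 a b c d * mx2 a' b' c' d' =
  mx2 (a * a' + b * c') (a * b' + b * d') (c * a' + d * c') (c * b' + d * d').
Proof.
apply/matrixP => i j; rewrite !mxE !big_ord_recl big_ord0 !mxE /= addr0.
by case/orP: (ord2E i) => /eqP ->; case/orP: (ord2E j) => /eqP ->.
Qed.

Lemma mx2_1 : 1 = mx2 1 0 0 1.
Proof. by rewrite [LHS]mx2E !mxE. Qed.

Lemma mx2N a b c d : - mx2 a b c d = mx2 (- a) (- b) (- c) (- d).
Proof. by rewrite [LHS]mx2E !mxE. Qed.

Lemma det_mx2 a b c d : \det (mx2 a b c d) = a * d - b * c.
Proof.
rewrite (expand_det_row _ 0) !big_ord_recl big_ord0 /cofactor !det_mx11 !mxE /=.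
by rewrite expr0 expr1; ring.
Qed.

Lemma tr_mx2 a b c d : \tr (mx2 a b c d) = a + d.
Proof. by rewrite /mxtrace !big_ord_recl big_ord0 !mxE addr0. Qed.

Lemma det1_unit M : \det M = 1 -> M \is a GRing.unit.
Proof. by move=> dM; rewrite -[_ \is a _]/(M \in unitmx) unitmxE dM unitr1. Qed.

Lemma invr_unique (R : unitRingType) (u v : R) :
  u \is a GRing.unit -> v * u = 1 -> u^-1 = v.
Proof. by move=> uu e; rewrite -[LHS]mul1r -e mulrK. Qed.

Lemma mx2V a b c d :
  a * d - b * c = 1 -> (mx2 a b c d)^-1 = mx2 d (- b) (- c) a.
Proof.
move=> dM; apply: invr_unique; first by rewrite det1_unit ?det_mx2.
rewrite mx2M mx2_1 -dM; congr mx2; ring.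
Qed.

(** Multiplying by a translation changes the trace by a multiple of the lower
    left entry; this is how translation lengths are read off from traces. *)
Lemma tr_shear_mul z M : \tr (mx2 1 z 0 1 * M) = \tr M + z * M 1 0.
Proof. by rewrite (mx2E M) mx2M !tr_mx2 !mxE /=; ring. Qed.

Lemma sqr_mx2_10 M : (M ^+ 2) 1 0 = M 1 0 * \tr M.
Proof. by rewrite expr2 (mx2E M) mx2M tr_mx2 !mxE /=; ring. Qed.

End TwoByTwo.

(** Lets an identity [u - v = w - z] checked by [ring] transport a known
    equation [u = v] into the desired one. *)
Lemma eq_of_subr (V : zmodType) (u v w z : V) : u = v -> u - v = w - z -> w = z.
Proof. by move=> -> /esym/eqP; rewrite subrr subr_eq0 => /eqP. Qed.

(** * The matrix relation *)

Section Relation.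
Variable F : numFieldType.
Variables (a b c d x y : F).
Hypothesis det1 : a * d - b * c = 1.
Local Notation A := (mx2 a b c d).
Local Notation T z := (mx2 1 z 0 1).
Local Notation s := (a + d).

Hypothesis rel : A ^+ 2 * T (- x) * A ^+ 3 * T (- x) * A ^+ 2 = T y.

(** Write the relation as [T(-x) A^3 T(-x) = A^-2 T(y) A^-2] and express powers
    of A through the trace by Cayley-Hamilton. With t = c x and w = c y, the lower
    left entries give [E1], which determines w, and the traces give [E2], which
    determines t as soon as s <> 1. For s = 1 (A of order three in PSL_2) the trace
    equation is void, and t comes from [E3], the vanishing of the lower left entry
    of the original product. *)
Lemma relation_trace : c != 0 -> (x != 0) || (y != 0) ->
  [/\ x != 0, s != 0, s * (y - x) = x
    & s * (s + 1) * (c * x) = s ^+ 3 + s ^+ 2 - 2 * s - 1].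
Proof.
move=> c0 xy0.
have A2 : A ^+ 2 = mx2 (a ^+ 2 + b * c) (b * s) (c * s) (d ^+ 2 + b * c).
  rewrite expr2 mx2M; congr mx2; ring.
pose B := mx2 (d ^+ 2 + b * c) (- (b * s)) (- (c * s)) (a ^+ 2 + b * c).
have BA : B * A ^+ 2 = 1.
  rewrite A2 mx2M mx2_1; have -> : 1 = (a * d - b * c) ^+ 2 by rewrite det1 expr1n.
  congr mx2; ring.
have AB : A ^+ 2 * B = 1.
  rewrite A2 mx2M mx2_1; have -> : 1 = (a * d - b * c) ^+ 2 by rewrite det1 expr1n.
  congr mx2; ring.
have mid : T (- x) * A ^+ 3 * T (- x) = B * T y * B.
  rewrite -rel; move: BA AB; move: (A ^+ 2) (A ^+ 3) => P Q BP PB.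
  by rewrite !mulrA BP mul1r -!mulrA PB mulr1.
move: (mid) rel; rewrite exprS A2 !mx2M.
move=> /mx2_inj [e00 _ e10 e11] /mx2_inj [_ _ f10 _].
(* The entries are homogenized by the determinant D, so that each equation
   follows from an identity of polynomials in a, b, c, d, x, y. *)
pose t := c * x; pose w := c * y; pose D := a * d - b * c.
have D1 : D = 1 := det1.
have E1 : s ^+ 2 - 1 = - s * (s ^+ 2 - 2) + w * s ^+ 2.
  apply: (mulfI c0); rewrite -D1; apply: (eq_of_subr e10); rewrite /w /D; ring.
have E2 : s ^+ 3 - 3 * s - 2 * t * (s ^+ 2 - 1) =
    s ^+ 4 - 4 * s ^+ 2 + 2 - w * s * (s ^+ 2 - 2).
  have -> : s ^+ 3 - 3 * s - 2 * t * (s ^+ 2 - 1) =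
    s ^+ 3 - 3 * s * D - 2 * t * (s ^+ 2 - D) by rewrite D1; ring.
  have -> : s ^+ 4 - 4 * s ^+ 2 + 2 - w * s * (s ^+ 2 - 2) =
    s ^+ 4 - 4 * s ^+ 2 * D + 2 * D ^+ 2 - w * s * (s ^+ 2 - 2 * D) by rewrite D1; ring.
  apply: (eq_of_subr (congr2 +%R e00 e11)); rewrite /t /w /D; ring.
have E3 : s ^+ 6 - 5 * s ^+ 4 + 6 * s ^+ 2 - 1 - 2 * t * s * (s ^+ 4 - 3 * s ^+ 2 + 1)
   + t ^+ 2 * s ^+ 2 * (s ^+ 2 - 1) = 0.
  have -> : s ^+ 6 - 5 * s ^+ 4 + 6 * s ^+ 2 - 1 - 2 * t * s * (s ^+ 4 - 3 * s ^+ 2 + 1)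
     + t ^+ 2 * s ^+ 2 * (s ^+ 2 - 1) =
    s ^+ 6 - 5 * s ^+ 4 * D + 6 * s ^+ 2 * D ^+ 2 - D ^+ 3
     - 2 * t * s * (s ^+ 4 - 3 * s ^+ 2 * D + D ^+ 2)
     + t ^+ 2 * s ^+ 2 * (s ^+ 2 - D) by rewrite D1; ring.
  apply: (mulfI c0); apply: (eq_of_subr f10); rewrite /t /D; ring.
have tw0 : (t != 0) || (w != 0) by rewrite /t /w !mulf_eq0 (negPf c0).
have s0 : s != 0.
  by apply: contra_eq_neq E1 => ->; 
    rewrite expr0n mulr0 oppr0 mul0r addr0 sub0r oppr_eq0 oner_eq0.
have E4 : s ^+ 2 * w = s ^+ 3 + s ^+ 2 - 2 * s - 1 by apply: (eq_of_subr (esym E1)); ring.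
have E5 : s * (s + 1) * t = s ^+ 3 + s ^+ 2 - 2 * s - 1.
  have [s1|s1] := eqVneq s 1.
    move: E3; rewrite s1 => E3; apply: (eq_of_subr E3); ring.
  (* After eliminating w, the trace equation is a multiple of s - 1. *)
  rewrite -subr_eq0 in s1; apply: (mulfI s1).
  have {}E2 : s * (s ^+ 3 - 3 * s - 2 * t * (s ^+ 2 - 1)) =
     s * (s ^+ 4 - 4 * s ^+ 2 + 2) - (s ^+ 2 - 2) * (s ^+ 2 * w) by rewrite E2; ring.
  rewrite E4 in E2.
  have two0 : (2 : F) != 0 by rewrite pnatr_eq0.
  apply: (mulfI two0); apply: (eq_of_subr (esym E2)); ring.
(* [E4] and [E5] have the same right-hand side; s is a common factor on the left. *)
have E6 : s * (w - t) = t.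
  apply: (mulfI s0); apply: (eq_of_subr (etrans E4 (esym E5))); ring.
have t0 : t != 0.
  apply: contraTneq tw0 => t0; rewrite t0 eqxx /= negbK.
  by move/eqP: E6; rewrite t0 subr0 mulf_eq0 (negPf s0).
split=> //.
- by apply: contra t0 => /eqP x0; rewrite /t x0 mulr0.
- by apply: (mulfI c0); rewrite -[RHS]/t -E6 /t /w; ring.
Qed.

End Relation.

(** * Equality up to sign *)

Section Sign.
Variable R : unitRingType.
Implicit Types u v w : R.

(** Equality in PSL_2 of elements given by lifts to SL_2. *)
Definition eqpm u v := u = v \/ u = - v.

Lemma eqpm_refl u : eqpm u u. Proof. by left. Qed.

Lemma eqpm_sym u v : eqpm u v -> eqpm v u.
Proof. by case=> ->; [left|right; rewrite opprK]. Qed.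

Lemma eqpm_trans v u w : eqpm u v -> eqpm v w -> eqpm u w.
Proof. by case=> -> [] ->; rewrite ?opprK; [left|right|right|left]. Qed.

Lemma eqpmM u v u' v' : eqpm u v -> eqpm u' v' -> eqpm (u * u') (v * v').
Proof. by case=> -> [] ->; rewrite ?mulrNN ?mulrN ?mulNr; [left|right|right|left]. Qed.

Lemma eqpmV u v : eqpm u v -> eqpm u^-1 v^-1.
Proof. by case=> ->; rewrite ?invrN; [left|right]. Qed.

Lemma eqpmX n u v : eqpm u v -> eqpm (u ^+ n) (v ^+ n).
Proof. by move=> uv; elim: n => [|n IH]; [left | rewrite !exprS; apply: eqpmM]. Qed.

Lemma eqpm_mul1 u v : v \is a GRing.unit -> eqpm (u * v) 1 -> eqpm u v^-1.
Proof. by move=> vu /eqpmM /(_ (eqpm_refl v^-1)); rewrite mulrK // mul1r. Qed.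

End Sign.

(** * Subgroups, generated groups and fields *)

Section Groups.
Variable R : unitRingType.
Implicit Types (H : set R) (u v : R).

Lemma divr_setP H :
  divr_closed [in H] <-> H 1 /\ forall u v, H u -> H v -> H (u / v).
Proof.
split=> [[H1 HD]|[H1 HD]].
  by split=> [|u v Hu Hv]; [move: H1|move: (HD u v)]; rewrite !in_setE //; apply.
by split=> [|u v]; rewrite !in_setE //; apply: HD.
Qed.

Section Closed.
Variable H : set R.
Hypothesis cH : divr_closed [in H].

Lemma divr_set1 : H 1. Proof. by case/divr_setP: cH. Qed.

Lemma divr_setV u : H u -> H u^-1.
Proof. by case/divr_setP: cH => H1 HD /(HD _ _ H1); rewrite div1r. Qed.

Lemma divr_setM u v : H u -> H v -> H (u * v).
Proof.
by move=> Hu /divr_setV Hv; case/divr_setP: cH => _ /(_ _ _ Hu Hv); rewrite invrK.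
Qed.

Lemma divr_setX n u : H u -> H (u ^+ n).
Proof.
by move=> Hu; elim: n => [|n IH]; [exact: divr_set1|rewrite exprS; apply: divr_setM].
Qed.

Lemma divr_set_pm u v : H (-1) -> eqpm u v -> H v -> H u.
Proof. by move=> HN [] -> // Hv; rewrite -mulN1r; apply: divr_setM. Qed.

End Closed.

Lemma divr_set_conj H g : divr_closed [in H] -> g \is a GRing.unit ->
  (forall u, H u -> u \is a GRing.unit) ->
  divr_closed [in [set g * u / g | u in H]].
Proof.
move=> cH gu Hu; apply/divr_setP; split.
  by exists 1; [exact: divr_set1|rewrite mulr1 divrr].
move=> _ _ [u uH <-] [v vH <-]; exists (u / v).
  by case/divr_setP: cH => _; apply.
have vu := Hu v vH.
by rewrite !invrM ?invrK ?unitrMl ?unitrV // !mulrA divrK.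
Qed.

End Groups.

Section Generation.
Variable R : realType.
Local Notation C := R[i].
Local Notation M2 := 'M[R[i]]_2.

Lemma gen_group_closed (S : set M2) : divr_closed [in gen_group S].
Proof.
apply/divr_setP; split=> [K [cK _]|u v Su Sv K [cK SK]]; first exact: divr_set1.
by case/divr_setP: (cK) => _; apply; [exact: Su|exact: Sv].
Qed.

Lemma gen_group_min (S H : set M2) :
  divr_closed [in H] -> S `<=` H -> gen_group S `<=` H.
Proof. by move=> cH SH; apply: smallest_sub. Qed.

Lemma gen_field_closed (S : set C) : divring_closed [in gen_field S].
Proof.
have cl (op : C -> C -> C) :
    (forall K : set C, divring_closed [in K] -> forall u v, K u -> K v -> K (op u v)) ->
  {in [in gen_field S] &, forall u v, op u v \in [in gen_field S]}.
  move=> opK u v; rewrite !in_setE => Su Sv K [cK SK].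
  by apply: opK => //; [exact: Su|exact: Sv].
split; first by rewrite in_setE => K [[K1 _ _] _]; rewrite in_setE in K1.
  by apply: (cl (fun u v => u - v)) => K [_ KB _] u v; have := KB u v; rewrite !in_setE; apply.
by apply: (cl (fun u v => u / v)) => K [_ _ KD] u v; have := KD u v; rewrite !in_setE; apply.
Qed.

Lemma gen_field_min (S K : set C) :
  divring_closed [in K] -> S `<=` K -> gen_field S `<=` K.
Proof. by move=> cK SK; apply: smallest_sub. Qed.

(** The generated field as a bundled closed predicate, so that the [rpred]
    lemmas apply to it. *)
Definition gen_divring (S : set C) : divringClosed C :=
  HB.pack_for (divringClosed C) ([in gen_field S] : {pred C})
    (GRing.isDivringClosed.Build C _ (gen_field_closed S)).

Lemma gen_divringE S z : (z \in gen_divring S) = gen_field S z :> Prop.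
Proof. exact: (in_setE (gen_field S) z). Qed.

End Generation.

(** * Conjugation and translations *)

Section Conj.
Variable F : fieldType.
Variable K : divringClosed F.

Definition SL2_over : set 'M[F]_2 :=
  [set M | \det M = 1 /\ forall i j, M i j \in K].

Lemma SL2_over_closed : divr_closed [in SL2_over].
Proof.
apply/divr_setP; split; first by split=> [|i j]; rewrite ?det1 // mxE rpred_nat.
move=> M N [dM KM] [dN KN].
split=> [|i j]; first by rewrite detM detV dM dN invr1 mulr1.
rewrite mxE; apply: rpred_sum => k _; apply: rpredM => //.
rewrite (mx2E N) mx2V; last by rewrite -det_mx2 -mx2E.
by rewrite mxE; case: ifP => _; case: ifP => _; rewrite ?rpredN.
Qed.

End Conj.

Section Conjugation.
Variables (R : unitRingType) (g : R).
Hypothesis gu : g \is a GRing.unit.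

Lemma conj_invrK u : g * (g^-1 * u * g) / g = u.
Proof. by rewrite !mulrA divrr // mul1r mulrK. Qed.

Lemma conj_mulr u v : (g * u / g) * (g * v / g) = g * (u * v) / g.
Proof. by rewrite !mulrA divrK. Qed.

Lemma conj_expr n u : (g * u / g) ^+ n = g * u ^+ n / g.
Proof.
elim: n => [|n IH]; first by rewrite !expr0 mulr1 divrr.
by rewrite !exprS IH conj_mulr.
Qed.

Lemma conj_invr u : u \is a GRing.unit -> (g * u / g)^-1 = g * u^-1 / g.
Proof. by move=> uu; rewrite !invrM ?unitrMl ?unitrV // invrK mulrA. Qed.

Lemma eqpm_conj u v : eqpm (g * u / g) (g * v / g) <-> eqpm u v.
Proof.
split=> [|[] ->]; last 2 first.
- by left.
- by right; rewrite mulrN mulNr.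
move=> /(eqpmM (eqpm_refl g^-1)) /eqpmM /(_ (eqpm_refl g)).
by rewrite !mulrA mulVr // !mul1r !divrK.
Qed.

Lemma eqpm_conjV u v : eqpm u (g * v / g) -> eqpm (g^-1 * u * g) v.
Proof. by move=> uv; apply/eqpm_conj; rewrite conj_invrK. Qed.

Lemma conj_sqrM u v : (g * u / g) ^+ 2 * (g * v / g) = g * (u ^+ 2 * v) / g.
Proof. by rewrite conj_expr conj_mulr. Qed.

Lemma conj_relator u v : g * (u ^+ 2 * v * u ^+ 3 * v * u ^+ 2) / g =
  (g * u / g) ^+ 2 * (g * v / g) * (g * u / g) ^+ 3 * (g * v / g) * (g * u / g) ^+ 2.
Proof. by rewrite !conj_expr !conj_mulr. Qed.

End Conjugation.

(** The conjugation fixes infinity; it is normalized by sending x to 1 and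
    the lower right entry of M to 0. Then the trace and the determinant determine
    the other entries of M. *)
Lemma SL2_normal_form (F : fieldType) (K : divringClosed F) (M : 'M[F]_2) (x : F) :
  \det M = 1 -> M 1 0 != 0 -> x != 0 -> \tr M \in K -> M 1 0 * x \in K ->
  exists P N : 'M[F]_2, [/\ P \is a GRing.unit, SL2_over K N, M * P = P * N
    & mx2 1 x 0 1 * P = P * mx2 1 1 0 1].
Proof.
rewrite (mx2E M) det_mx2 tr_mx2 !mxE /=.
move: (M 0 0) (M 0 1) (M 1 0) (M 1 1) => a b c d dM c0 x0 sK tK.
have cx0 : c * x != 0 by rewrite mulf_neq0.
exists (mx2 x (- (d / c)) 0 1), (mx2 (a + d) (- (c * x)^-1) (c * x) 0); split.
- rewrite -[_ \is a _]/(_ \in unitmx) unitmxE det_mx2.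
  by rewrite mulr0 subr0 mulr1 unitfE.
- split=> [|i j]; first by rewrite det_mx2 mulr0 sub0r mulNr opprK mulVf.
  by rewrite mxE; case: ifP => _; case: ifP => _; rewrite ?rpredN ?rpredV ?rpred0.
- have bE : b = (a * d - 1) / c by rewrite -dM opprB addrC subrK mulfK.
  by rewrite !mx2M bE; congr mx2; field; rewrite ?c0 ?x0.
- by rewrite !mx2M; congr mx2; ring.
Qed.

Section Translations.
Variable R : realType.
Local Notation C := R[i].
Implicit Types z : C.

Lemma translE z : transl z = mx2 1 z 0 1.
Proof. by rewrite [LHS]mx2E !mxE. Qed.

Lemma translD z1 z2 : transl z1 * transl z2 = transl (z1 + z2).
Proof. by rewrite !translE mx2M; congr mx2; ring. Qed.

Lemma det_transl z : \det (transl z) = 1.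
Proof. by rewrite translE det_mx2; ring. Qed.

Lemma transl0 : transl (0 : C) = 1.
Proof. by rewrite translE mx2_1. Qed.

Lemma translV z : (transl z)^-1 = transl (- z).
Proof.
by apply: invr_unique; [rewrite det1_unit ?det_transl
  |rewrite translD addNr transl0].
Qed.

Lemma translX z n : transl z ^+ n = transl (z *+ n).
Proof. by elim: n => [|n IH]; rewrite ?transl0 // exprS IH translD mulrS. Qed.

Lemma eqpm_transl z1 z2 : eqpm (transl z1) (transl z2) -> z1 = z2.
Proof.
rewrite !translE; case; rewrite ?mx2N => /mx2_inj [] // /eqP.
by rewrite -addr_eq0 -[1 + 1]/(2%:R) pnatr_eq0.
Qed.

Lemma Im_ratio_real (u v : R) (e : C) :
  complex.Im (e * v%:C%C / (e * u%:C%C)) = 0.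
Proof.
have [->|e0] := eqVneq e 0; first by rewrite !mul0r.
rewrite -mulf_div divff // mul1r; by rewrite -fmorph_div.
Qed.

End Translations.

Lemma tr_conj (F : fieldType) (g u : 'M[F]_2) :
  g \is a GRing.unit -> \tr (g * u / g) = \tr u.
Proof.
move=> gu; rewrite -[LHS]mxtrace_mulC.
by rewrite -[g^-1 *m _]/(g^-1 * (g * u)) mulKr.
Qed.

(** Replacing M by -M removes the sign from the relation and affects none of
    the conclusions. *)
Lemma relation_field (F : numFieldType) (K : divringClosed F)
    (M : 'M[F]_2) (x y : F) :
  \det M = 1 -> M 1 0 != 0 -> (x != 0) || (y != 0) ->
  eqpm (M ^+ 2 * mx2 1 (- x) 0 1 * M ^+ 3 * mx2 1 (- x) 0 1 * M ^+ 2)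
       (mx2 1 y 0 1) ->
  [/\ x != 0, \tr M != 0 & y / x \in K -> \tr M \in K /\ M 1 0 * x \in K].
Proof.
move=> dM c0 xy0.
wlog rel : M dM c0 / M ^+ 2 * mx2 1 (- x) 0 1 * M ^+ 3 * mx2 1 (- x) 0 1 * M ^+ 2
    = mx2 1 y 0 1 => [hw|_].
  case=> rel; first by apply: hw => //; left.
  have := hw (- M); rewrite linearN mxE mulNr !oppr_eq0 !rpredN; apply=> //.
  - by rewrite -scaleN1r detZ sqrrN expr1n mul1r.
  - by rewrite !sqrrN exprNn -signr_odd /= expr1 mulN1r mulrN !mulNr rel opprK.
  - by left; rewrite !sqrrN exprNn -signr_odd /= expr1 mulN1r mulrN !mulNr rel opprK.
move: dM c0 rel; rewrite (mx2E M) det_mx2 tr_mx2 !mxE /=.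
set a := M 0 0; set b := M 0 1; set c := M 1 0; set d := M 1 1 => dM c0 rel.
have [x0 s0 sE tE] := relation_trace dM rel c0 xy0.
have sV : a + d = (y / x - 1)^-1.
  rewrite -[LHS]invrK; congr _^-1; rewrite -[1](divff x0) -mulrBl.
  by apply: (mulfI s0); rewrite mulrA sE !divff.
split=> // yxK.
have sK : a + d \in K by rewrite sV rpredV rpredB ?rpred1.
split=> //.
have s1 : a + d + 1 != 0.
  apply: contra_eq_neq tE => /eqP; rewrite addr_eq0 => /eqP ->.
  rewrite addNr mulr0 mul0r eq_sym.
  by have -> : (-1) ^+ 3 + (-1) ^+ 2 - 2 * -1 - 1 = 1 :> F by ring.
have -> : c * x = ((a + d) ^+ 3 + (a + d) ^+ 2 - 2 * (a + d) - 1) /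
                  ((a + d) * (a + d + 1)).
  by rewrite -tE mulrAC divff ?mul1r // mulf_neq0.
move: (a + d) sK => s sK.
by rewrite rpred_div ?rpredB ?rpredD ?rpredM ?rpredX ?rpredD ?rpred_nat ?rpred1.
Qed.

(** * Groups with a cusp satisfying the relation *)

Section CuspedGroup.
Variable R : realType.
Local Notation C := R[i].
Local Notation M2 := 'M[R[i]]_2.
Variables (G : set M2) (g A X Y : M2) (m l : C).
Hypothesis cG : divr_closed [in G].
Hypothesis detG : forall h, G h -> \det h = 1.
Hypothesis detg : \det g = 1.
Hypothesis lat : cusp_lattice G g m l.
Hypothesis GA : G A.
Hypothesis GX : stabilizer G g X.
Hypothesis GY : stabilizer G g Y.
Hypothesis relY : eqpm Y (A ^+ 2 / X * A ^+ 3 / X * A ^+ 2).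
Hypothesis genG : G `<=` gen_group [set -1; A; X].
Hypothesis genS : stabilizer G g `<=` gen_group [set -1; X; Y].

Let gu : g \is a GRing.unit := det1_unit detg.

Section Coordinates.
Variables x y : C.
Hypothesis hX : eqpm X (g * transl x / g).
Hypothesis hY : eqpm Y (g * transl y / g).

(** Since X and Y generate the stabilizer, the cusp lattice, defined through m
    and l, is also spanned by x and y. *)
Lemma stabilizer_span h : stabilizer G g h ->
  exists i j : int, eqpm h (g * transl (x *~ i + y *~ j) / g).
Proof.
pose T : set M2 := [set u | exists i j : int, eqpm u (transl (x *~ i + y *~ j))].
have Tcl : divr_closed [in T].
  apply/divr_setP; split; first by exists 0, 0; rewrite !mulr0z addr0 transl0; left.
  move=> u v [i [j uE]] [i' [j' vE]]; exists (i - i'), (j - j').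
  have -> : transl (x *~ (i - i') + y *~ (j - j')) =
      transl (x *~ i + y *~ j) / transl (x *~ i' + y *~ j').
    by rewrite translV translD !mulrzBr; congr transl; ring.
  by apply: eqpmM => //; apply: eqpmV.
have Tu u : T u -> u \is a GRing.unit.
  by move=> [i [j]] [] ->; rewrite ?unitrN det1_unit ?det_transl.
move=> /genS Sh; suff: [set g * u / g | u in T] h.
  by move=> [u [i [j uE]] <-]; exists i, j; apply: (eqpm_conj gu _ _).2.
have cl := divr_set_conj Tcl gu Tu.
apply: (gen_group_min cl) Sh => u [[->|->]|->].
- exists (-1); last by rewrite mulrN1 mulNr divrr.
  by exists 0, 0; rewrite !mulr0z addr0 transl0; right.
- exists (g^-1 * X * g); last by rewrite conj_invrK.
  exists 1, 0; rewrite mulr1z mulr0z addr0; exact (eqpm_conjV gu hX).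
- exists (g^-1 * Y * g); last by rewrite conj_invrK.
  exists 0, 1; rewrite mulr1z mulr0z add0r; exact (eqpm_conjV gu hY).
Qed.

Lemma lattice_span (i j : int) :
  exists i' j' : int, m *~ i + l *~ j = x *~ i' + y *~ j'.
Proof.
have /stabilizer_span [i' [j' E]] : stabilizer G g (g * transl (m *~ i + l *~ j) / g).
  by apply/(lat.2); exists i, j; left.
by exists i', j'; apply: eqpm_transl; apply: (eqpm_conj gu _ _).1.
Qed.

(** A dependency would make x and y real multiples of one number e; then so
    would be m and l, and l / m would be real. *)
Lemma span_indep (i j : int) : x *~ i + y *~ j = 0 -> i = 0 /\ j = 0.
Proof.
move=> xy0; case: (pselect (i = 0 /\ j = 0)) => // ij0.
have [e [r1 [r2 [xE yE]]]] : exists e (r1 r2 : R), x = e * r1%:C%C /\ y = e * r2%:C%C.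
  have [j0|j0] := eqVneq j 0.
    exists y, 0, 1; rewrite mulr0 mulr1; split=> //.
    move: xy0; rewrite j0 mulr0z addr0 => /eqP; rewrite mulrz_eq0.
    by case/orP => /eqP // i0; case: ij0.
  exists x, 1, (- i%:~R / j%:~R); rewrite mulr1; split=> //.
  have jC : (j%:~R : C) != 0 by rewrite intr_eq0.
  apply: (mulIf jC); rewrite -mulrA rmorphM fmorphV rmorphN !rmorph_int.
  rewrite divfK // mulrN !mulrzr; apply/eqP; rewrite -addr_eq0 addrC; exact/eqP.
have [i1 [j1]] := lattice_span 1 0; have [i2 [j2]] := lattice_span 0 1.
rewrite !mulr0z !mulr1z addr0 add0r => lE mE.
have comb (i' j' : int) : x *~ i' + y *~ j' = e * (r1 *~ i' + r2 *~ j')%:C%C.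
  by rewrite xE yE -!mulrzAr -mulrDr rmorphD; congr (_ * (_ + _)); rewrite [RHS]rmorphMz.
have := lat.1; rewrite lE mE !comb Im_ratio_real ltxx; by [].
Qed.

Lemma relation_conj N : eqpm A (g * N / g) ->
  eqpm (N ^+ 2 * transl (- x) * N ^+ 3 * transl (- x) * N ^+ 2) (transl y).
Proof.
move=> hA; apply: (eqpm_conj gu _ _).1; apply: eqpm_trans hY; apply: eqpm_sym.
apply: eqpm_trans relY _; rewrite (conj_relator gu).
have hXV : eqpm X^-1 (g * transl (- x) / g).
  rewrite -translV -(conj_invr gu); first exact: eqpmV hX.
  exact/det1_unit/det_transl.
exact (eqpmM (eqpmM (eqpmM (eqpmM (eqpmX 2 hA) hXV) (eqpmX 3 hA)) hXV) (eqpmX 2 hA)).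
Qed.

Local Notation N := (g^-1 * A * g).

Lemma conjKA : g * N / g = A.
Proof. exact: conj_invrK. Qed.

(** If A fixed the same point as the peripheral group, it would belong to the
    lattice spanned by x and y, as some z with [7 z = 2 x + y]: the relation has
    exponent sum 7 in A and -2 in X. But (2 x + y) / 7 is not in that lattice. *)
Lemma conj_ll : N 1 0 != 0.
Proof.
apply/eqP => c0; have /stabilizer_span [i [j hA]] : stabilizer G g A by split.
move/relation_conj: hA; rewrite !translX !translD => /eqpm_transl E.
suff [_ ?] : (7 * i - 2 = 0 /\ 7 * j - 1 = 0)%R by lia.
apply: span_indep; move: E => /eqP; rewrite -subr_eq0 => /eqP <-.
by ring.
Qed.

Lemma det_conj : \det N = 1.
Proof. by rewrite !detM detV detg invr1 mul1r mulr1 detG. Qed.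

Lemma conj_params :
  [/\ x != 0, \tr N != 0
    & forall K : divringClosed C, y / x \in K -> \tr N \in K /\ N 1 0 * x \in K].
Proof.
have xy0 : (x != 0) || (y != 0).
  rewrite -negb_and; apply/negP => /andP [/eqP x0 /eqP y0].
  by have [] : (1 : int) = 0 /\ (0 : int) = 0
    by apply: span_indep; rewrite x0 y0 !mul0rz addr0.
have hA : eqpm A (g * N / g) by left; rewrite conjKA.
have := relation_conj hA; rewrite !translE => rel.
have rK K := @relation_field _ K _ _ _ det_conj conj_ll xy0 rel.
split=> [||K]; last by have [] := rK K.
  by have [] := rK (gen_divring set0).
by have [] := rK (gen_divring set0).
Qed.

(** All of G is conjugate into SL_2(K), because its generators are. *)
Lemma trace_over (K : divringClosed C) h : y / x \in K -> G h -> \tr h \in K.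
Proof.
have [x0 _ NK] := conj_params => /NK [sK tK] Gh.
have [P [N' [Pu N'K NP TP]]] := SL2_normal_form det_conj conj_ll x0 sK tK.
have TK : SL2_over K (transl 1).
  split=> [|i j]; first exact: det_transl.
  by rewrite translE mxE; case: ifP => _; case: ifP => _; rewrite ?rpred0 ?rpred1.
have Ku u : SL2_over K u -> u \is a GRing.unit by case=> /det1_unit.
have Qu : g * P \is a GRing.unit by rewrite unitrMl.
have cl := divr_set_conj (SL2_over_closed K) Qu Ku.
have conjP u v : u * P = P * v -> g * u / g = g * P * v / (g * P).
  by move=> e; rewrite invrM // !mulrA -(mulrA g P v) -e !mulrA mulrK.
have clN : [set (g * P) * u / (g * P) | u in SL2_over K] (-1).
  exists (-1); last by rewrite mulrN1 mulNr divrr.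
  split=> [|i j]; first by rewrite -scaleN1r detZ sqrrN expr1n mul1r det1.
  by rewrite !mxE rpredN rpred_nat.
have [u [_ uK] <-] : [set (g * P) * u / (g * P) | u in SL2_over K] h.
  move/genG: Gh; apply: (gen_group_min cl) => v [[->|->]|->] //.
    by exists N' => //; rewrite -(conjP _ _ NP) conjKA.
  apply: (divr_set_pm cl clN hX); exists (transl 1); first exact: TK.
  by apply/esym/conjP; rewrite !translE.
by rewrite tr_conj // rpred_sum.
Qed.

End Coordinates.

Lemma stabilizer_coord h : stabilizer G g h ->
  exists i j : int, eqpm h (g * transl (m *~ i + l *~ j) / g).
Proof. by move/(lat.2). Qed.

Lemma m_neq0 : m != 0.
Proof. by apply: contraTneq lat.1 => ->; rewrite invr0 mulr0 ltxx. Qed.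

Lemma ratio_over (K : divringClosed C) (i j i' j' : int) : l / m \in K ->
  (m *~ i + l *~ j) / (m *~ i' + l *~ j') \in K.
Proof.
move=> lmK.
have E (i1 j1 : int) : m *~ i1 + l *~ j1 = m * (i1%:~R + l / m * j1%:~R).
  by rewrite mulrDr mulrzr mulrA [m * (l / m)]mulrC divfK ?m_neq0 // mulrzr.
rewrite !E -mulf_div divff ?m_neq0 // mul1r.
by apply: rpred_div; apply: rpredD; rewrite ?rpred_int //; apply: rpredM; rewrite ?rpred_int.
Qed.

Lemma trace_field_sub_cusp_field : trace_field G `<=` cusp_field m l.
Proof.
have [i [j hX]] := stabilizer_coord GX; have [i' [j' hY]] := stabilizer_coord GY.
apply: gen_field_min; first exact: gen_field_closed.
move=> _ [h Gh <-]; rewrite -[cusp_field m l _]gen_divringE.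
apply: (trace_over hX hY) => //; apply: ratio_over.
by rewrite gen_divringE => K [_]; apply.
Qed.

(** Squares are needed only to stay in the invariant subgroup: the square of A
    still moves the cusp since both its trace and its lower left entry are
    nonzero, and squaring a translation doubles its length. *)
Lemma cusp_field_sub_invariant : cusp_field m l `<=` invariant_trace_field G.
Proof.
have [i [j hX]] := stabilizer_coord GX; have [i' [j' hY]] := stabilizer_coord GY.
have [_ s0 _] := conj_params hX hY; have c0 := conj_ll hX hY.
apply: gen_field_min; first exact: gen_field_closed.
pose sq := [set h ^+ 2 | h in G].
have sqG h : G h -> gen_group sq (h ^+ 2) by move=> Gh K [_]; apply; exists h.
pose K := gen_divring [set \tr h | h in gen_group sq].
have trK h : gen_group sq h -> \tr h \in K.
  by move=> Sh; rewrite gen_divringE => L [_]; apply; exists h.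
pose N := g^-1 * A * g; pose e := 2 * (N 1 0 * \tr N).
have e0 : e != 0 by rewrite !mulf_neq0 // pnatr_eq0.
have zK z : (exists i1 j1 : int, z = m *~ i1 + l *~ j1) -> z * e \in K.
  move=> [i1 [j1 zE]].
  have [GT _] : stabilizer G g (g * transl z / g).
    by apply/(lat.2); exists i1, j1; left; rewrite zE.
  have A2 : A ^+ 2 = g * N ^+ 2 / g by rewrite -(conj_expr gu) (conj_invrK gu).
  have -> : z * e = \tr ((g * transl z / g) ^+ 2 * A ^+ 2) - \tr (A ^+ 2).
    rewrite A2 (conj_sqrM gu).
    rewrite [X in _ = X - _](tr_conj (transl z ^+ 2 * N ^+ 2) gu).
    rewrite [X in _ = _ - X](tr_conj (N ^+ 2) gu).
    rewrite (translX z) translE tr_shear_mul.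
    by rewrite sqr_mx2_10 addrC addKr mulrnAl mulr2n /e; ring.
  apply: rpredB; apply: trK; last exact: sqG.
  by apply: (divr_setM (gen_group_closed sq)); apply: sqG.
move=> _ ->; rewrite -[invariant_trace_field G _]gen_divringE.
have -> : l / m = (l * e) / (m * e) by rewrite -mulf_div divff // mulr1.
by apply: rpred_div; apply: zK; [exists 0, 1|exists 1, 0]; rewrite mulr0z mulr1z ?add0r ?addr0.
Qed.

Lemma invariant_sub_trace_field : invariant_trace_field G `<=` trace_field G.
Proof.
apply: gen_field_min; first exact: gen_field_closed.
move=> _ [h Sh <-] K [_]; apply; exists h => //.
apply: gen_group_min Sh => // _ [u Gu <-]; exact: divr_setX.
Qed.

Theorem cusped_group_fields : trace_field G = invariant_trace_field G /\
  invariant_trace_field G = cusp_field m l.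
Proof.
have tc := trace_field_sub_cusp_field; have ci := cusp_field_sub_invariant.
have it := invariant_sub_trace_field.
by split; apply/seteqP; split=> // z /=; [move/tc/ci|move/it/tc].
Qed.

End CuspedGroup.

(** * The fundamental group of the Berge manifold *)

Section BergeGroup.
Variable U : unitRingType.

(** The values that the relations force, up to sign, once the letters (0, 2)
    and (0, 3) have the values A and B. *)
Definition letter (A B : U) (a : face) : U :=
  match a with
  | (i0, i2) => A | (i1, i1) => A^-1
  | (i0, i3) => B | (i1, i3) => B^-1
  | (i2, i0) => A^-1 | (i3, i0) => A
  | (i2, i2) => A * B^-1 * A | (i3, i1) => A^-1 * B * A^-1
  | (i2, i3) => B * B | (i3, i3) => B^-1 * B^-1
  | _ => 1
  end.

Variable rho : face -> U.
Hypothesis rho_unit : forall a, rho a \is a GRing.unit.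
Local Notation val w := (\prod_(a <- w) rho a).
Hypothesis rho_rel : forall r, berge_rel r -> eqpm (val r) 1.
Local Notation A := (rho (i0, i2)).
Local Notation B := (rho (i0, i3)).
Let Au : A \is a GRing.unit := rho_unit _.
Let Bu : B \is a GRing.unit := rho_unit _.

(* Reduces words in A and B as in the free group. *)
Let cancel := (@mulr1 U, @mul1r U, @mulrA U, @invrK U, mulrK Au, mulrVK Au, mulrK Bu,
  mulrVK Bu, mulVr Au, divrr Au, mulVr Bu, divrr Bu).

Lemma rho_tree a : in_tree a -> eqpm (rho a) 1.
Proof. by move/rel_tree/rho_rel; rewrite big_seq1. Qed.

Lemma rho_opp a : eqpm (rho (opp_face a)) (rho a)^-1.
Proof.
have := rho_rel (rel_face a); rewrite big_cons big_seq1 => /(eqpmM (eqpm_refl (rho a)^-1)).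
by rewrite mulKr // mulr1.
Qed.

Lemma rho_edge t f g : f <> g ->
  eqpm (val (edge_word (t, f, g))) 1.
Proof. by move=> fg; apply/rho_rel/rel_edge. Qed.

Ltac edge t f g :=
  have := @rho_edge t f g ltac:(by []);
  rewrite /edge_word /= !big_cons big_nil mulr1.

Lemma rho00 : eqpm (rho (i0, i0)) 1. Proof. exact: rho_tree. Qed.
Lemma rho01 : eqpm (rho (i0, i1)) 1. Proof. exact: rho_tree. Qed.
Lemma rho12 : eqpm (rho (i1, i2)) 1. Proof. exact: rho_tree. Qed.

Lemma rho_opp_letter a u : eqpm (rho a) u -> eqpm (rho (opp_face a)) u^-1.
Proof. by move=> au; apply: eqpm_trans (rho_opp a) (eqpmV au). Qed.

Lemma rho10 : eqpm (rho (i1, i0)) 1.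
Proof. by have := rho_opp_letter rho00; rewrite invr1. Qed.
Lemma rho21 : eqpm (rho (i2, i1)) 1.
Proof. by have := rho_opp_letter rho01; rewrite invr1. Qed.
Lemma rho32 : eqpm (rho (i3, i2)) 1.
Proof. by have := rho_opp_letter rho12; rewrite invr1. Qed.

Lemma eqpm_insert (l r u : U) : eqpm u 1 -> eqpm (l * u * r) (l * r).
Proof.
move=> u1; rewrite -[X in eqpm _ (X * r)]mulr1.
exact: eqpmM (eqpmM (eqpm_refl l) u1) (eqpm_refl r).
Qed.

Lemma rho11 : eqpm (rho (i1, i1)) A^-1. Proof. exact: rho_opp (i0, i2). Qed.
Lemma rho13 : eqpm (rho (i1, i3)) B^-1. Proof. exact: rho_opp (i0, i3). Qed.

Lemma rho20 : eqpm (rho (i2, i0)) A^-1.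
Proof.
edge i0 i1 i0 => e; apply: eqpm_mul1 => //.
have /eqpm_sym := eqpmM rho01 (eqpmM (eqpm_refl (rho (i2, i0)))
  (eqpmM rho32 (eqpmM rho10 (eqpmM (eqpm_refl A) rho10)))).
by rewrite !mul1r mulr1 => /eqpm_trans; apply.
Qed.

Lemma rho23 : eqpm (rho (i2, i3)) (B * B).
Proof.
edge i0 i0 i3 => e.
have /eqpm_sym/eqpm_trans/(_ e) := eqpmM rho00 (eqpmM rho13
  (eqpmM rho01 (eqpmM (eqpm_refl (rho (i2, i3))) (eqpmM rho32 rho13)))).
by move/(eqpm_insert B B); rewrite !cancel.
Qed.

Lemma rho22 : eqpm (rho (i2, i2)) (A * B^-1 * A).
Proof.
edge i0 i1 i2 => e.
have /eqpm_sym/eqpm_trans/(_ e) := eqpmM rho01 (eqpmM (eqpm_refl (rho (i2, i2)))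
  (eqpmM rho32 (eqpmM rho11 (eqpmM (eqpm_refl B) rho11)))).
by move/(eqpm_insert 1 (A * B^-1 * A)); rewrite !cancel.
Qed.

Lemma rho30 : eqpm (rho (i3, i0)) A.
Proof. by have := rho_opp_letter rho20; rewrite invrK. Qed.

Lemma rho31 : eqpm (rho (i3, i1)) (A^-1 * B * A^-1).
Proof.
have := rho_opp_letter rho22.
by rewrite !invrM ?unitrMl ?unitrV // invrK !mulrA.
Qed.

Lemma rho33 : eqpm (rho (i3, i3)) (B^-1 * B^-1).
Proof. by have := rho_opp_letter rho23; rewrite invrM. Qed.

Lemma rho_letter a : eqpm (rho a) (letter A B a).
Proof.
have r := eqpm_refl; case: a => -[] [] /=;
  by [exact: rho00|exact: rho01|exact: r|exact: rho10|exact: rho11|exact: rho12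
     |exact: rho13|exact: rho20|exact: rho21|exact: rho22|exact: rho23
     |exact: rho30|exact: rho31|exact: rho32|exact: rho33].
Qed.

(** Three of the four edges only express letters through A and B; the last one
    gives the single relator. *)
Lemma berge_relator :
  eqpm (A * B^-1 * A * A * B * B) (B * B * A * A * B^-1 * A).
Proof.
edge i2 i0 i2 => e.
have L := rho_letter.
have /eqpm_sym/eqpm_trans/(_ e) := eqpmM (L (i2, i0)) (eqpmM (L (i3, i3)) (eqpmM (L (i2, i2))
  (eqpmM (L (i3, i0)) (eqpmM (L (i2, i3)) (L (i3, i1)))))).
by move/(eqpm_insert (B * B * A) (A * B^-1 * A)); rewrite /letter !cancel.
Qed.

(** Membership of an ideal vertex in the cusp c, in the convention of
    [cusp_base]. *)
Definition in_cusp (c : bool) (u : idx * idx) : bool :=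
  match u with (i2, i1) | (i3, i2) => c | _ => ~~ c end.

(** The value of a chosen path from the base triangle of a cusp to a triangle of
    its cross-section, for both cusps at once. *)
Definition potential (u : idx * idx) : U :=
  match u with
  | (i3, i2) => A^-1
  | (i1, i0) | (i3, i0) => A
  | (i1, i2) | (i0, i2) => B
  | (i3, i3) | (i1, i3) => A * B^-1 * A
  | (i3, i1) | (i1, i1) => B * B
  | (i0, i1) => A * B^-1
  | (i0, i3) => B * A^-1
  | (i2, i2) => A * B^-1 * A * A
  | (i2, i3) => B * B * A
  | _ => 1
  end.

(** Generators of the peripheral group of each cusp, based at [cusp_base]. The
    signs of the exponents are chosen so that [loop_y_relator] has the same form
    for both cusps. *)
Definition loop_x (c : bool) : U :=
  if c then A * B^-1 * A * A else B * B * B * A^-1.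
Definition loop_y (c : bool) : U :=
  if c then B * B * A else B * B * A * A * B^-1.

Lemma loop_xV c : (loop_x c)^-1 =
  if c then A^-1 * A^-1 * B * A^-1 else A * B^-1 * B^-1 * B^-1.
Proof.
by case: c; apply: invr_unique; rewrite ?cancel // !unitrMl ?unitrV ?Au ?Bu.
Qed.

Lemma loop_yV c : (loop_y c)^-1 =
  if c then A^-1 * B^-1 * B^-1 else B * A^-1 * A^-1 * B^-1 * B^-1.
Proof.
by case: c; apply: invr_unique; rewrite ?cancel // !unitrMl ?unitrV ?Au ?Bu.
Qed.

(** One step of a path in the cross-section, closed up along the potentials, is
    a loop; over all triangles and sides only the loops
    1, x^+-1, y^+-1, (x^-1 y)^+-1 occur. *)
Lemma cross_side c (H : set U) t v f :
  divr_closed [in H] -> H (loop_x c) -> H (loop_y c) ->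
  f <> v -> in_cusp c (t, v) ->
  let y := ((Defs.glue (t, f)).1, (Defs.glue (t, f)).2 v) in
  in_cusp c y /\
  exists2 h, H h & eqpm (potential (t, v) * rho (t, f)) (h * potential y).
Proof.
move=> cH HX HY fv tv y; split.
  by move: tv fv; rewrite {}/y {HX HY}; case: t; case: v; case: f => //= _ [].
suff [h Hh hE] : exists2 h, H h &
    eqpm (potential (t, v) * letter A B (t, f)) (h * potential y).
  exists h => //; apply: eqpm_trans hE; apply: eqpmM; [exact: eqpm_refl|exact: rho_letter].
have H1 := divr_set1 cH; have HXV := divr_setV cH HX; have HYV := divr_setV cH HY.
have HVXY := divr_setM cH HXV HY; have HVYX := divr_setM cH HYV HX.
move: tv H1 HX HY HXV HYV HVXY HVYX; rewrite {}/y loop_xV loop_yV {cH}.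
case: c => tv H1 HX HY HXV HYV HVXY HVYX; move: tv fv;
  case: t; case: v => //=; case: f => //= _ fv; (by case: fv) ||
    first [exists 1; [exact: H1|by left; rewrite !cancel]
          |eexists; [exact: HX|by left; rewrite !cancel]
          |eexists; [exact: HY|by left; rewrite !cancel]
          |eexists; [exact: HXV|by left; rewrite !cancel]
          |eexists; [exact: HYV|by left; rewrite !cancel]
          |eexists; [exact: HVXY|by left; rewrite !cancel]
          |eexists; [exact: HVYX|by left; rewrite !cancel]
          |idtac].
  (* The two remaining sides are those where the loop is y or its inverse only
     modulo the relator; for all others this holds in the free group. *)
  by exists (B * B * A * A * B^-1) => //; rewrite !cancel; exact: berge_relator.
exists (B * A^-1 * A^-1 * B^-1 * B^-1) => //; apply: eqpm_sym.
have := eqpmM (eqpm_refl (B * A^-1 * A^-1 * B^-1 * B^-1))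
  (eqpmM berge_relator (eqpm_refl (B^-1 * B^-1))).
by rewrite !cancel.
Qed.

Lemma link_path_val c (H : set U) u w v :
  divr_closed [in H] -> H (loop_x c) -> H (loop_y c) ->
  link_path u w v -> in_cusp c u ->
  in_cusp c v /\ exists2 h, H h & eqpm (potential u * val w) (h * potential v).
Proof.
move=> cH HX HY; elim=> [x xc|t y f {}w z fy _ IH tc].
  split=> //; exists 1; first exact: divr_set1.
  by rewrite big_nil mulr1 mul1r; left.
have [nc [h Hh hE]] := cross_side cH HX HY fy tc.
have [zc [h' Hh' hE']] := IH nc; split=> //; exists (h * h'); first exact: divr_setM.
rewrite big_cons mulrA; apply: eqpm_trans (eqpmM hE (eqpm_refl _)) _.
by rewrite -!mulrA; apply: eqpmM => //; left.
Qed.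

Lemma peripheral_sub c (H : set U) w : divr_closed [in H] -> H (-1) ->
  H (loop_x c) -> H (loop_y c) -> peripheral c w -> H (val w).
Proof.
move=> cH HN HX HY /(link_path_val cH HX HY) [|_ [h Hh]]; first by case: (c).
have -> : potential (cusp_base c) = 1 by case: (c).
by rewrite mul1r mulr1 => hE; exact: divr_set_pm hE Hh.
Qed.

Definition loop_x_word (c : bool) : word :=
  if c then [:: (i2, i2); (i3, i0)]
  else [:: (i0, i1); (i2, i3); (i3, i2); (i1, i0); (i0, i3); (i1, i1)].

Definition loop_y_word (c : bool) : word :=
  if c then [:: (i2, i3); (i3, i0)]
  else [:: (i0, i1); (i2, i3); (i3, i0); (i2, i1); (i0, i2); (i1, i3)].

Lemma peripheral_loop_x c : peripheral c (loop_x_word c).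
Proof. by case: c; do ?[apply: link_cons => //=]; exact: link_nil. Qed.

Lemma peripheral_loop_y c : peripheral c (loop_y_word c).
Proof. by case: c; do ?[apply: link_cons => //=]; exact: link_nil. Qed.

Lemma eqpm_val w : eqpm (val w) (\prod_(a <- w) letter A B a).
Proof.
elim: w => [|a w IH]; first by rewrite !big_nil; left.
by rewrite !big_cons; apply: eqpmM IH; exact: rho_letter.
Qed.

Lemma val_loop_x c : eqpm (val (loop_x_word c)) (loop_x c).
Proof.
apply: eqpm_trans (eqpm_val _) _.
by case: c; rewrite /loop_x_word !big_cons big_nil /loop_x /= !cancel; left.
Qed.

Lemma val_loop_y c : eqpm (val (loop_y_word c)) (loop_y c).
Proof.
apply: eqpm_trans (eqpm_val _) _.
by case: c; rewrite /loop_y_word !big_cons big_nil /loop_y /= !cancel; left.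
Qed.

(** An element that generates the group together with the loop x. *)
Definition transverse (c : bool) : U := if c then A else B.

Lemma loop_y_relator c : loop_y c =
  transverse c ^+ 2 / loop_x c * transverse c ^+ 3 / loop_x c * transverse c ^+ 2.
Proof. by rewrite loop_xV expr2 !exprS expr0; case: c; rewrite /= !cancel. Qed.

Lemma val_sub c (H : set U) w : divr_closed [in H] -> H (-1) ->
  H (transverse c) -> H (loop_x c) -> H (val w).
Proof.
move=> cH HN Ht HX; have HXV := divr_setV cH HX.
have M u v : H u -> H v -> H (u * v) := @divr_setM _ _ cH u v.
have [HA HB] : H A /\ H B.
  move: Ht HX HXV; rewrite loop_xV; case: c => /= Ht HX HXV; split=> //.
    by have := M _ _ (M _ _ (M _ _ Ht Ht) HXV) Ht; rewrite !cancel.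
  by have := M _ _ (M _ _ (M _ _ HXV Ht) Ht) Ht; rewrite !cancel.
have [HAV HBV] := (divr_setV cH HA, divr_setV cH HB).
elim: w => [|a w IH]; first by rewrite big_nil; exact: divr_set1.
rewrite big_cons; apply: (M _ _ _ IH); apply: (divr_set_pm cH HN (rho_letter a)).
by case: a => -[] [] /=; first [exact: divr_set1|do ?apply: (M)].
Qed.

Lemma val_unit w : val w \is a GRing.unit.
Proof.
elim: w => [|a w IH]; first by rewrite big_nil unitr1.
by rewrite big_cons unitrMl.
Qed.

Lemma val_winv w : eqpm (val (winv w)) (val w)^-1.
Proof.
elim: w => [|a w IH]; first by rewrite !big_nil invr1; left.
rewrite /winv map_cons rev_cons -cats1 big_cat big_seq1 big_cons invrM ?val_unit //.
exact: eqpmM IH (rho_opp a).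
Qed.

End BergeGroup.

(** * Fillings *)

Section Holonomy.
Variables (R : realType) (rho : face -> 'M[R[i]]_2).
Hypothesis rho_det : forall a, \det (rho a) = 1.
Hypothesis rho_rel : forall r, berge_rel r -> eqpm (wordval rho r) 1.
Local Notation G := (holonomy_group rho).

Let rho_unit a : rho a \is a GRing.unit := det1_unit (rho_det a).

Lemma holonomy_closed : divr_closed [in G].
Proof.
apply/divr_setP; split; first by exists [::]; left; rewrite /wordval big_nil.
move=> u v [w uw] [z vz]; exists (w ++ winv z); rewrite /wordval big_cat.
apply: (eqpmM uw); apply: eqpm_trans (eqpmV vz) _; apply: eqpm_sym.
exact: val_winv.
Qed.

Lemma det_holonomy h : G h -> \det h = 1.
Proof.
have dw w : \det (wordval rho w) = 1.
  by elim: w => [|a w IH]; rewrite /wordval ?big_nil ?det1 // big_cons detM rho_det mul1r.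
by case=> w [] ->; rewrite ?dw // -scaleN1r detZ sqrrN expr1n mul1r dw.
Qed.

Lemma holonomy_transverse c : G (transverse rho c).
Proof.
by case: c; [exists [:: (i0, i2)]|exists [:: (i0, i3)]]; left;
  rewrite /wordval big_seq1.
Qed.

Lemma holonomy_sub c :
  G `<=` gen_group [set -1; transverse rho c; loop_x rho c].
Proof.
move=> h [w hw]; have cl := gen_group_closed [set -1; transverse rho c; loop_x rho c].
have HN : gen_group [set -1; transverse rho c; loop_x rho c] (-1).
  by apply: sub_gen_smallest; left; left.
apply: (divr_set_pm cl HN hw); apply: (@val_sub _ _ rho_unit rho_rel c _ w cl HN).
  by apply: sub_gen_smallest; left; right.
by apply: sub_gen_smallest; right.
Qed.

Lemma wordval_peripheral_sub c w : peripheral c w ->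
  gen_group [set -1; loop_x rho c; loop_y rho c] (wordval rho w).
Proof.
have cl := gen_group_closed [set -1; loop_x rho c; loop_y rho c].
apply: (peripheral_sub rho_unit rho_rel cl); apply: sub_gen_smallest.
- by left; left.
- by left; right.
- by right.
Qed.

End Holonomy.

Theorem theorem5p3 (R : realType) (c : bool) (mu lam : word) (p q : int)
    (rho : face -> 'M[R[i]]_2) (g : 'M[R[i]]_2) (m l : R[i]) :
  generating_pair c mu lam ->
  (p, q) <> (0, 0) ->
  hyperbolic_filling c mu lam p q rho g ->
  cusp_lattice (holonomy_group rho) g m l ->
  trace_field (holonomy_group rho) = invariant_trace_field (holonomy_group rho)
  /\ invariant_trace_field (holonomy_group rho) = cusp_field m l.
Proof.
move=> _ _ [rho_det faithful _ _ detg cusp] lat.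
have rho_rel r : berge_rel r -> eqpm (wordval rho r) 1.
  move=> rr; apply/faithful; rewrite -[r]cats0.
  by apply: (@eqw_rel _ [::] r [::]); left.
have rho_unit a : rho a \is a GRing.unit := det1_unit (rho_det a).
have GX : stabilizer (holonomy_group rho) g (loop_x rho (~~ c)).
  apply/cusp; exists (loop_x_word (~~ c)); first exact: peripheral_loop_x.
  exact: eqpm_sym (val_loop_x rho_unit rho_rel _).
have GY : stabilizer (holonomy_group rho) g (loop_y rho (~~ c)).
  apply/cusp; exists (loop_y_word (~~ c)); first exact: peripheral_loop_y.
  exact: eqpm_sym (val_loop_y rho_unit rho_rel _).
apply: (cusped_group_fields (holonomy_closed rho_det rho_rel)
  (det_holonomy rho_det) detg lat (holonomy_transverse rho (~~ c)) GX GY).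
- by left; exact: loop_y_relator.
- exact: holonomy_sub.
- move=> h /cusp [w pw hw].
  apply: (divr_set_pm (gen_group_closed _) _ hw); last exact: wordval_peripheral_sub.
  by apply: sub_gen_smallest; left; left.
Qed.
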